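(* Let $p$ be a prime and let $A$ be a brace of size $p^n$ in which both the additive and the multiplicative group are cyclic; identify $(A,+)$ with $\mathbb{Z}/p^n$. Let $x\in A$ be contained in a transitive cycle base of $A$ and let $(X,r):=(A,r_x)$. Let $k\in\mathbb{N}$ be such that $a\circ b=a+b+abp^k$ for all $a,b\in A$, where $ab$ is the product in the ring $\mathbb{Z}/p^n$. Then $\mathrm{Aut}(X,r)$ is isomorphic to $(A,+)$ if and only if $k=0$ or $k\geq \frac{n}{2}$, and it is isomorphic to $(p^{n-2k}A,+)$ otherwise.
   Context: $\mathbb{N}$ contains $0$. A brace is a triple $(A,+,\circ)$ with $(A,+)$ an abelian group, $(A,\circ)$ a group (the multiplicative group), and $a\circ(b+c)=a\circ b-a+a\circ c$. It is known (Rump) that for a brace of size $p^n$ with cyclic additive group, identified with $\mathbb{Z}/p^n$, and abelian multiplicative group, such a $k$ exists (for a suitable identification). Put $\lambda_a(b)=-a+a\circ b$. A transitive cycle base of a brace $A$ is a subset that is a single orbit of the action $\lambda$ of $(A,\circ)$ on $A$ and generates $(A,+)$. A solution is a pair $(X,r)$ with $X$ a nonempty set and $r:X^2\to X^2$ a bijection, $r(x,y)=(\sigma_x(y),\tau_y(x))$, satisfying the braid equation $(r\times \mathrm{id})(\mathrm{id}\times r)(r\times \mathrm{id})=(\mathrm{id}\times r)(r\times \mathrm{id})(\mathrm{id}\times r)$ with all $\sigma_x,\tau_x$ bijective. $\mathrm{Aut}(X,r)$ is the group of bijections $f:X\to X$ with $(f\times f)r=r(f\times f)$. For $x$ in a transitive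 cycle base of the brace $A$, $r_x(a,b)=(\sigma_a(b),\sigma^{-1}_{\sigma_a(b)}(a))$ with $\sigma_a(b)=\lambda_a(x)\circ b$; it is known that $(A,r_x)$ is an indecomposable involutive solution. *)

(* Defs.v *)
From HB Require Import structures.
From mathcomp Require Import all_boot all_algebra all_fingroup all_solvable.

Set Implicit Arguments.
Unset Strict Implicit.
Unset Printing Implicit Defensive.

Import GRing.Theory.
Local Open Scope ring_scope.

(* The first six fields say that (A, circ) is a group; that its identity is
   the zero of (A, +) is a consequence of circDr and is not assumed. *)
HB.mixin Record isBrace A of GRing.Zmodule A := {
  circ : A -> A -> A;
  circ_id : A;
  circ_inv : A -> A;
  circA : associative circ;
  circ1x : left_id circ_id circ;
  circVx : left_inverse circ_id circ_inv circ;
  circDr : forall a b c : A, circ a (b + c) = circ a b - a + circ a c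
}.

#[short(type="braceType")]
HB.structure Definition Brace := {A of GRing.Zmodule A & isBrace A}.

#[short(type="finBraceType")]
HB.structure Definition FinBrace := {A of Brace A & FinRing.Zmodule A}.

Notation "a \o+ b" := (circ a b)
  (at level 40, left associativity, format "a  \o+  b") : ring_scope.

(* MathComp regards a finZmodType as a finGroupType through its addition; the
   same is done here, so a finBraceType A, seen as a finGroupType, is (A, +).
   The group (A, circ) lives on the alias circ_group A. *)
#[non_forgetful_inheritance]
HB.instance Definition _ (A : finBraceType) := [finGroupMixin of A for +%R].

Definition circ_group (A : finBraceType) : Type := A.

HB.instance Definition _ (A : finBraceType) := Finite.on (circ_group A).
HB.instance Definition _ (A : finBraceType) :=
  Finite_isGroup.Build (circ_group A) (@circA A) (@circ1x A) (@circVx A).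

Definition lambda (A : braceType) (a b : A) : A := - a + a \o+ b.

Definition transitive_cycle_base (A : finBraceType) (C : {set A}) : Prop :=
  (exists y : A, C = [set lambda a y | a : A]) /\ <<C>>%g = [set: A].

Lemma circ_inj (A : braceType) (a : A) : injective (circ a).
Proof.
move=> b c eq_bc; rewrite -[b]circ1x -[c]circ1x -(circVx a).
by rewrite -!circA eq_bc.
Qed.

Section CycleBaseSolution.

Variables (A : finBraceType) (x : A).

Definition sigma (a : A) : {perm A} := perm (@circ_inj A (lambda a x)).

Definition cycle_base_sol (u : A * A) : A * A :=
  (sigma u.1 u.2, (sigma (sigma u.1 u.2))^-1%g u.1).

End CycleBaseSolution.

Section SolutionAutomorphisms.

Variables (X : finType) (r : X * X -> X * X).

Definition map_pair (f : X -> X) (u : X * X) : X * X := (f u.1, f u.2).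

Definition sol_Aut : {set {perm X}} :=
  [set f : {perm X} | [forall u, map_pair f (r u) == r (map_pair f u)]].

Lemma sol_Aut_group_set : group_set sol_Aut.
Proof.
apply/group_setP; split.
  rewrite inE; apply/forallP => u.
  have id1 v : map_pair (1%g : {perm X}) v = v.
    by case: v => a b; rewrite /map_pair !perm1.
  by rewrite !id1.
move=> f g; rewrite !inE => /forallP f_r /forallP g_r; apply/forallP => u.
have compM v : map_pair (f * g)%g v = map_pair g (map_pair f v).
  by rewrite /map_pair /= !permM.
by rewrite !compM (eqP (f_r u)) (eqP (g_r _)).
Qed.

Canonical sol_Aut_group := Group sol_Aut_group_set.

End SolutionAutomorphisms.

(* Main.v *)
(* Put q = p^k. An automorphism f of the solution is a permutation with
   f sigma_a = sigma_(f a) f. As sigma_a is the circle translation by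
   x (1 + q a), and x generates the circle group, such an f is determined by
   c = f 0, and f b = c o b^m (circle power) where x^m = x (1 + q c).
   Conversely this f is an automorphism iff q (m - 1) = 0, that is, iff
   q^2 c = 0, so there are p^min(n, 2k) automorphisms.
   The engine is b^m = m b (1 + p r), which fails only when p = 2 and k = 1,
   a case where the circle group is not cyclic unless n <= 1. Applied to
   f^i 0 = c^(1 + m + ... + m^(i-1)), which is thus i c up to a unit, it shows
   that c = p^(n - min(n, 2k)) gives an f of order p^min(n, 2k), so that the
   automorphism group is cyclic. *)

Require Import Defs.
From HB Require Import structures.
From mathcomp Require Import all_boot all_algebra all_fingroup all_solvable.
From mathcomp Require Import ring zify.

Set Implicit Arguments.
Unset Strict Implicit.
Unset Printing Implicit Defensive.

Import GRing.Theory.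
Local Open Scope ring_scope.

(** * Circle powers over a commutative ring *)

Section CircleOperation.

Variables (R : comPzRingType) (q : R).

Definition cadd (a b : R) : R := a + b + a * b * q.

(** The quotient ((1 + q b)^m - 1) / (q b), kept as a sum because q b need not be invertible; b
    times it is the m-th circle power of b, in line with 1 + q (a o b) = (1 + q a)(1 + q b). *)
Definition geo (m : nat) (b : R) : R := \sum_(i < m) (1 + q * b) ^+ i.

Definition cpow (m : nat) (b : R) : R := b * geo m b.

Lemma caddC : commutative cadd.
Proof. by move=> a b; rewrite /cadd; ring. Qed.

Lemma caddA : associative cadd.
Proof. by move=> a b c; rewrite /cadd; ring. Qed.

Lemma cadd0x : left_id 0 cadd.
Proof. by move=> a; rewrite /cadd; ring. Qed.

Lemma geo0 b : geo 0 b = 0.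
Proof. exact: big_ord0. Qed.

Lemma geoS m b : geo m.+1 b = 1 + (1 + q * b) * geo m b.
Proof.
rewrite /geo big_ord_recl expr0 mulr_sumr; congr (_ + _).
by apply: eq_bigr => i _; rewrite exprS.
Qed.

Lemma one_cpow m b : 1 + q * cpow m b = (1 + q * b) ^+ m.
Proof.
elim: m => [|m IHm]; first by rewrite /cpow geo0 !mulr0 addr0.
by rewrite exprS -IHm /cpow geoS; ring.
Qed.

Lemma geoD i j b : geo (i + j) b = geo i b + (1 + q * b) ^+ i * geo j b.
Proof.
elim: i => [|i IHi]; first by rewrite geo0 add0n add0r mul1r.
by rewrite addSn !geoS IHi exprS; ring.
Qed.

(** The i j powers of 1 + q b split into j blocks of length i, and the ratio (1 + q b)^i between
    blocks is 1 + q [cpow i b]. *)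
Lemma geoM i j b : geo (i * j) b = geo i b * geo j (cpow i b).
Proof.
elim: j => [|j IHj]; first by rewrite muln0 !geo0 mulr0.
by rewrite mulnS geoD IHj geoS one_cpow; ring.
Qed.

Lemma geo_affine m b : exists r, geo m b = m%:R + q * b * r.
Proof.
elim: m => [|m [r IHm]]; first by exists 0; rewrite geo0 mulr0 addr0.
exists (m%:R + r + q * b * r); rewrite geoS IHm -natr1; ring.
Qed.

Lemma geo_quadratic m b :
  exists r, geo m b = m%:R + 'C(m, 2)%:R * (q * b) + (q * b) ^+ 2 * r.
Proof.
elim: m => [|m [r IHm]]; first by exists 0; rewrite geo0 !mulr0 mul0r !addr0.
exists ('C(m, 2)%:R + r + q * b * r).
by rewrite geoS IHm binS bin1 natrD -natr1; ring.
Qed.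

Lemma cpow0 b : cpow 0 b = 0.
Proof. by rewrite /cpow geo0 mulr0. Qed.

Lemma cpowS m b : cpow m.+1 b = cadd b (cpow m b).
Proof. by rewrite /cpow /cadd geoS; ring. Qed.

Lemma cpowD i j b : cpow (i + j) b = cadd (cpow i b) (cpow j b).
Proof.
elim: i => [|i IHi]; first by rewrite cpow0 cadd0x.
by rewrite addSn !cpowS IHi caddA.
Qed.

Lemma cpowM i j b : cpow (i * j) b = cpow j (cpow i b).
Proof. by rewrite {1}/cpow geoM mulrA. Qed.

Lemma cpow_cadd m a b : cpow m (cadd a b) = cadd (cpow m a) (cpow m b).
Proof.
elim: m => [|m IHm]; first by rewrite !cpow0 cadd0x.
by rewrite !cpowS IHm /cadd; ring.
Qed.

Lemma iter_cadd_cpow m c i :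
  iter i (fun b => cadd c (cpow m b)) 0 = cpow (\sum_(j < i) m ^ j)%N c.
Proof.
elim: i => [|i IHi]; first by rewrite big_ord0 cpow0.
rewrite iterS IHi -cpowM big_ord_recl -cpowS -add1n; congr (cpow (_ + _) c).
by rewrite big_distrl; apply: eq_bigr => j _ /=; rewrite -expnSr.
Qed.

End CircleOperation.

Lemma cadd_inj (R : comUnitRingType) (q a : R) :
  1 + q * a \is a GRing.unit -> injective (cadd q a).
Proof.
move=> ua b c eq_bc; apply: (mulrI ua); apply: (addrI a).
have E d : a + (1 + q * a) * d = cadd q a d by rewrite /cadd; ring.
by rewrite !E.
Qed.

(** * Units and divisibility in Z/p^n *)

Section PrimePower.

Variables (p n : nat).
Hypotheses (p_prime : prime p) (n_gt0 : (0 < n)%N).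

Notation R := 'Z_(p ^ n).

Lemma pn_gt1 : (1 < p ^ n)%N.
Proof. by rewrite -(exp1n n) ltn_exp2r // prime_gt1. Qed.

Lemma Zpn_natr_eq0 (i : nat) : (i%:R == 0 :> R) = (p ^ n %| i)%N.
Proof. by rewrite -val_eqE /= (val_Zp_nat pn_gt1). Qed.

Lemma Zpn_natr_eq (i j : nat) : (i%:R == j%:R :> R) = (i == j %[mod p ^ n])%N.
Proof. by rewrite -val_eqE /= !(val_Zp_nat pn_gt1). Qed.

Lemma Zpn_natrE (a : R) : a = (a : nat)%:R.
Proof. by rewrite natr_Zp. Qed.

Lemma Zpn_unit (i : nat) : ((i%:R : R) \is a GRing.unit) = ~~ (p %| i)%N.
Proof. by rewrite (unitZpE _ pn_gt1) coprime_pexpl // prime_coprime. Qed.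

Lemma Zpn_unitD (a b : R) :
  (a + p%:R * b \is a GRing.unit) = (a \is a GRing.unit).
Proof.
rewrite (Zpn_natrE a) (Zpn_natrE b) -natrM -natrD !Zpn_unit.
by rewrite dvdn_addl // dvdn_mulr.
Qed.

Lemma unit_1pr (r : R) : 1 + p%:R * r \is a GRing.unit.
Proof. by rewrite Zpn_unitD unitr1. Qed.

Lemma Zpn_factor (a : R) : a != 0 ->
  exists e u, [/\ a = p%:R ^+ e * u, u \is a GRing.unit & (e < n)%N].
Proof.
rewrite (Zpn_natrE a) Zpn_natr_eq0 => nz.
have a_gt0 : (0 < (a : nat))%N by case: (a : nat) nz; rewrite ?dvdn0.
have [u co_pu a_eq] := pfactor_coprime p_prime a_gt0.
exists (logn p a), u%:R; split.
- by rewrite {1}a_eq natrM natrX mulrC.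
- by rewrite Zpn_unit -prime_coprime.
by rewrite ltnNge -pfactor_dvdn.
Qed.

Lemma Zpn_pexp_eq0 (e : nat) (u : R) : u \is a GRing.unit ->
  (p%:R ^+ e * u == 0) = (n <= e)%N.
Proof.
move=> uu; rewrite -(mul0r u) (inj_eq (mulIr uu)) -natrX Zpn_natr_eq0.
by rewrite dvdn_Pexp2l ?prime_gt1.
Qed.

(** * Circle powers as multiples up to a unit *)

Variable k : nat.
Hypotheses (k_gt0 : (0 < k)%N) (k_tame : [|| n <= k, odd p | 1 < k]%N).

Notation q := ((p ^ k)%:R : R).

Lemma q_pmul : q = p%:R * (p ^ k.-1)%:R.
Proof. by rewrite -natrM -expnS prednK. Qed.

Lemma unit_1q (b : R) : 1 + q * b \is a GRing.unit.
Proof. by rewrite q_pmul -mulrA unit_1pr. Qed.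

Lemma Zpn_cadd_inj (a : R) : injective (cadd q a).
Proof. exact: cadd_inj (unit_1q a). Qed.

(** Strong induction on m, peeling off a factor p by [geoM]. If p does not divide m, then m is a
    unit and absorbs the correction. For m = p the term C(p, 2) q c has to be divisible by p^2: an
    odd p divides C(p, 2), and for p = 2 the assumption k > 1 gives 4 | q. *)
Lemma geo_unit (m : nat) (b : R) :
  exists r, geo q m b = m%:R * (1 + p%:R * r).
Proof.
have [le_nk | lt_kn] := leqP n k.
  exists 0; have [r ->] := geo_affine q m b.
  have -> : q = 0 by apply/eqP; rewrite Zpn_natr_eq0 dvdn_exp2l.
  by ring.
have {lt_kn}k_tame' : odd p \/ p = 2%N /\ (1 < k)%N.
  move: k_tame; rewrite leqNgt lt_kn /=.
  case/orP => [-> | k_gt1]; [by left | ].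
  by case: (even_prime p_prime) => [-> | ->]; [right | left].
elim/ltn_ind: m b => m IHm b.
have [m_le1 | m_gt1] := leqP m 1.
  exists 0; case: m m_le1 {IHm} => [|[|//]] _.
    by rewrite geo0 mul0r.
  by rewrite geoS geo0; ring.
have [p_m | p'm] := boolP (p %| m)%N; last first.
  have [r ->] := geo_affine q m b.
  have um : (m%:R : R) \is a GRing.unit by rewrite Zpn_unit.
  exists ((p ^ k.-1)%:R * b * r / m%:R); rewrite q_pmul.
  transitivity (m%:R + p%:R * ((p ^ k.-1)%:R * b * r) * (m%:R / m%:R) : R).
    by rewrite divrr //; ring.
  by ring.
have geo_p c : exists r, geo q p c = p%:R * (1 + p%:R * r).
  have [r ->] := geo_quadratic q p c.
  case: k_tame' => [p_odd | [p2 k_gt1]].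
    have [h ->] : exists h, 'C(p, 2) = (p * h)%N.
      have p_gt2 : (0 < 2 < p)%N by rewrite odd_prime_gt2.
      have /dvdnP[h ->] := prime_dvd_bin p_prime p_gt2.
      by exists h; rewrite mulnC.
    exists (h%:R * ((p ^ k.-1)%:R * c) + ((p ^ k.-1)%:R * c) ^+ 2 * r).
    by rewrite q_pmul natrM; ring.
  exists ((p ^ k.-2)%:R * c + p%:R * ((p ^ k.-2)%:R * c) ^+ 2 * r * p%:R).
  have -> : 'C(p, 2) = 1%N by rewrite p2.
  have -> : q = p%:R * p%:R * (p ^ k.-2)%:R.
    by rewrite -!natrM -mulnA -!expnS; case: k k_gt1 => [|[]].
  by ring.
have /dvdnP[j m_eq] := p_m.
have j_lt : (j < m)%N.
  by rewrite m_eq ltn_Pmulr ?prime_gt1 //; case: j m_eq m_gt1 => [->|].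
have [r geo_j] := IHm j j_lt b; have [r' geo_p'] := geo_p (cpow q j b).
exists (r + r' + p%:R * r * r').
by rewrite m_eq geoM geo_j geo_p' natrM; ring.
Qed.

Lemma cpow_natr (m : nat) (b : R) :
  exists r, cpow q m b = m%:R * b * (1 + p%:R * r).
Proof.
by have [r geo_m] := geo_unit m b; exists r; rewrite /cpow geo_m; ring.
Qed.

Lemma cpow_eq0 (m : nat) (b : R) : (cpow q m b == 0) = (m%:R * b == 0).
Proof.
have [r ->] := cpow_natr m b.
by rewrite -{1}(mul0r (1 + p%:R * r)) (inj_eq (mulIr (unit_1pr r))).
Qed.

(** Additivity of the power map reduces this to its kernel: [w] is the circle quotient of b' by b,
    and w^m = 0 means m w = 0. *)
Lemma cpow_inj (m : nat) : ~~ (p %| m)%N -> injective (cpow q m).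
Proof.
rewrite -Zpn_unit => um b b' eq_bb'.
pose w := (b' - b) / (1 + q * b).
have b'E : b' = cadd q b w.
  transitivity (b + (1 + q * b) * w); last by rewrite /cadd; ring.
  by rewrite mulrC divrK ?unit_1q //; ring.
have /eqP : cpow q m w = 0.
  apply: (@Zpn_cadd_inj (cpow q m b)).
  by rewrite -cpow_cadd -b'E -eq_bb' caddC cadd0x.
rewrite cpow_eq0 mulrI_eq0; last exact: mulrI.
by move/eqP=> w0; rewrite b'E w0 caddC cadd0x.
Qed.

(** Since x^i = 0 exactly when p^n | i, the powers with i < p^n are distinct. Indexing them by R
    itself turns injectivity into bijectivity. *)
Lemma cpow_surj (x b : R) : x \is a GRing.unit -> exists m, b = cpow q m x.
Proof.
move=> ux; pose h (i : R) := cpow q i x.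
have h_inj : injective h.
  have h_lt (i j : R) : (i < j)%N -> h i <> h j.
    move=> lt_ij; rewrite /h -(subnKC (ltnW lt_ij)) cpowD => eq_h.
    have /eqP : cpow q (j - i) x = 0.
      by apply: (@Zpn_cadd_inj (cpow q i x)); rewrite -eq_h caddC cadd0x.
    rewrite cpow_eq0 mulrC mulrI_eq0; last exact: mulrI.
    rewrite Zpn_natr_eq0 gtnNdvd ?subn_gt0 //.
    apply: leq_ltn_trans (leq_subr i j) (leq_trans (ltn_ord j) _).
    by rewrite Zp_cast // pn_gt1.
  move=> i j eq_h; apply: ord_inj.
  by case: (ltngtP i j) => // [/h_lt | /h_lt] []; rewrite eq_h.
have [g _ gK] := injF_bij h_inj.
by exists (g b); rewrite [RHS]gK.
Qed.

(** * When b -> c o b^m respects the translations *)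

Section Twist.

Variables (x c : R) (d : nat).
Hypotheses (ux : x \is a GRing.unit) (xc : cpow q d.+1 x = x * (1 + q * c)).

(** Here d stands for m - 1. Cancelling x in x (1 + q c) = x + (1 + q x) x^d, with x^d = d x up to a
    unit, shows that q c and d are associates, so q^2 c = 0 can be traded for q d = 0. *)
Lemma twist_multiplier : exists2 u, u \is a GRing.unit & q * c = d%:R * u.
Proof.
have [r dx] := cpow_natr d x.
exists ((1 + q * x) * (1 + p%:R * r)).
  by rewrite unitrM unit_1q unit_1pr.
apply: (mulrI ux); apply: (addrI x).
transitivity (cpow q d.+1 x); first by rewrite xc; ring.
by rewrite cpowS dx /cadd; ring.
Qed.

(* To leading order the condition at [a] reads [q d a x = 2 q d a x]; for
   necessity, [a] is chosen so that [z = q d a] is killed by [p], which makes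
   the leading order exact. *)
Lemma twist_compatible :
  (forall a, cpow q d.+1 (x * (1 + q * a)) =
             x * (1 + q * cadd q c (cpow q d.+1 a))) <->
  q * q * c = 0.
Proof.
have [u uu qc] := twist_multiplier.
have -> : q * q * c = 0 <-> q * d%:R = 0 :> R.
  rewrite -mulrA qc mulrA; split=> [/eqP|->]; last exact: mul0r.
  by rewrite mulIr_eq0 => [/eqP|]; last exact: mulIr.
(* The circle quotient of x (1 + q a) by x, so that the power on the left splits as x^d o (w
   a)^d. *)
pose w a := q * a * x / (1 + q * x).
have xsE a : x * (1 + q * a) = cadd q x (w a).
  transitivity (x + (1 + q * x) * w a); last by rewrite /cadd; ring.
  by rewrite [_ * w a]mulrC /w divrK ?unit_1q //; ring.
have lhsE a : cpow q d.+1 (x * (1 + q * a)) = x * (1 + q * a) +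
    (1 + q * (x * (1 + q * a))) *
    (cpow q d x + (1 + q * cpow q d x) * cpow q d (w a)).
  by rewrite cpowS {2}xsE cpow_cadd /cadd; ring.
have rhsE a : x * (1 + q * cadd q c (cpow q d.+1 a)) =
    (x + (1 + q * x) * cpow q d x) * (1 + q * a) * (1 + q * cpow q d a).
  transitivity (x * (1 + q * c) * (1 + q * cpow q d.+1 a)).
    by rewrite /cadd; ring.
  by rewrite -xc !cpowS /cadd; ring.
split=> [compat | qd0 a]; last first.
  rewrite lhsE rhsE.
  have [r1 ->] := cpow_natr d x; have [r2 ->] := cpow_natr d a.
  have -> : cpow q d (w a) = 0.
    apply/eqP; rewrite cpow_eq0 /w; apply/eqP.
    transitivity (q * d%:R * (a * x / (1 + q * x))); last by rewrite qd0 mul0r.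
    by ring.
  set g1 := 1 + p%:R * r1; set g2 := 1 + p%:R * r2.
  transitivity (x * (1 + q * a) + d%:R * x * g1 +
                (q * d%:R) * (x * (1 + q * a) * x * g1)); first by ring.
  transitivity (x * (1 + q * a) + d%:R * x * g1 + (q * d%:R) *
    (x * a * g2 * (1 + q * a) + (a + x * (1 + q * a)) * x * g1 +
     (1 + q * x) * x * g1 * (1 + q * a) * d%:R * a * g2)); last by ring.
  by rewrite qd0 !mul0r.
apply/eqP/negPn/negP => /Zpn_factor[e [v [qdE uv lt_en]]].
(* This exponent raises the valuation of [z] to n - 1, the largest one of a nonzero element, so p, q
   and d all annihilate [z]. *)
pose a : R := p%:R ^+ (n.-1 - e); pose z := q * d%:R * a.
have zE : z = p%:R ^+ n.-1 * v.
  by rewrite /z qdE /a mulrAC -exprD subnKC // -ltnS prednK.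
have z_neq0 : z != 0 by rewrite zE Zpn_pexp_eq0 // leqNgt ltn_predL n_gt0.
have pz : p%:R * z = 0.
  by apply/eqP; rewrite zE mulrA -exprS Zpn_pexp_eq0 // prednK.
have qz : q * z = 0 by rewrite q_pmul mulrAC pz mul0r.
have dz : d%:R * z = 0.
  rewrite -[d%:R](mulrK uu) -qc.
  transitivity (q * z * (c / u)); first by ring.
  by rewrite qz mul0r.
have [r1 dx] := cpow_natr d x; have [r2 da] := cpow_natr d a.
have [r3 dw] := cpow_natr d (w a).
have {}da : q * cpow q d a = z.
  transitivity (z + p%:R * z * r2); first by rewrite da /z; ring.
  by rewrite pz mul0r addr0.
have {}dw : cpow q d (w a) = z * x.
  rewrite dw /w; set t := (1 + q * x)^-1.
  have ut : t * (1 + q * x) = 1 by rewrite mulVr // unit_1q.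
  transitivity (z * x * (t * (1 + q * x)) + p%:R * z * (x * t * r3)
                - q * z * (x * x * t)); first by rewrite /z; ring.
  by rewrite ut pz qz !mul0r subr0 addr0 mulr1.
have ax : q * a * cpow q d x = z * x.
  transitivity (z * x + p%:R * z * (x * r1)); first by rewrite dx /z; ring.
  by rewrite pz mul0r addr0.
have xz : cpow q d x * z = 0.
  transitivity (d%:R * z * (x * (1 + p%:R * r1))); first by rewrite dx; ring.
  by rewrite dz mul0r.
have := compat a; rewrite lhsE rhsE da dw; set y := cpow q d x in ax xz *.
move=> compat_a; have /eqP : x * z = 0.
  (* The difference of the two sides of [compat_a], corrected by multiples of q a y - z x, q z and y
     z, all of which vanish. *)
  transitivity ((x + (1 + q * x) * y) * (1 + q * a) * (1 + z) -
    (x * (1 + q * a) +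
     (1 + q * (x * (1 + q * a))) * (y + (1 + q * y) * (z * x))) -
    (q * a * y - z * x) - q * z * (x * a - x * (x * (1 + q * a) + y +
      q * x * (1 + q * a) * y)) - (1 + q * x) * (1 + q * a) * (y * z)).
    by ring.
  by rewrite compat_a ax xz qz !subrr mul0r mulr0 !subr0.
rewrite mulrI_eq0; last exact: mulrI.
by apply/negP.
Qed.

End Twist.

(** * Self-maps of Z/p^n intertwining the translations *)

Section Endomorphisms.

Variable x : R.
Hypothesis ux : x \is a GRing.unit.

(** The unit x generates the circle group. As x^m is again a unit and equals m x up to a unit, m is
    prime to p, in particular nonzero. *)
Lemma multiplier_exists (c : R) :
  exists2 d, cpow q d.+1 x = x * (1 + q * c) & ~~ (p %| d.+1)%N.
Proof.
have [m ym] := cpow_surj (x * (1 + q * c)) ux.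
have p'm : ~~ (p %| m)%N.
  have [r m_x] := cpow_natr m x; rewrite -Zpn_unit.
  have : x * (1 + q * c) \is a GRing.unit by rewrite unitrM ux unit_1q.
  by rewrite ym m_x -mulrA unitrM => /andP[].
by case: m p'm ym => [|d] p'm ym; [rewrite dvdn0 in p'm | exists d].
Qed.

Definition sigma_endo (F : R -> R) := forall a b,
  F (cadd q (x * (1 + q * a)) b) = cadd q (x * (1 + q * F a)) (F b).

(** At a = 0 the equation says that F carries translation by x to translation by x (1 + q F 0); this
    is iterated from 0. *)
Lemma sigma_endo_cpow F i : sigma_endo F ->
  F (cpow q i x) = cadd q (cpow q i (x * (1 + q * F 0))) (F 0).
Proof.
move=> F_endo; elim: i => [|i IHi]; first by rewrite !cpow0 cadd0x.
have := F_endo 0 (cpow q i x); rewrite mulr0 addr0 mulr1 -cpowS => ->.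
by rewrite IHi cpowS !caddA.
Qed.

Lemma sigma_endo_eq F F' :
  sigma_endo F -> sigma_endo F' -> F 0 = F' 0 -> F =1 F'.
Proof.
move=> F_endo F'_endo eq0 b; have [i ->] := cpow_surj b ux.
by rewrite !sigma_endo_cpow // eq0.
Qed.

(** F is forced to be b -> F 0 o b^m; its equation at b = 0 is then the condition of
    [twist_compatible]. *)
Lemma sigma_endo_image0 F : sigma_endo F -> q * q * F 0 = 0.
Proof.
move=> F_endo; have [d xd _] := multiplier_exists (F 0).
have shape b : F b = cadd q (F 0) (cpow q d.+1 b).
  have [i ->] := cpow_surj b ux.
  by rewrite sigma_endo_cpow // -xd -!cpowM mulnC caddC.
apply/(twist_compatible ux xd) => a; apply: (@Zpn_cadd_inj (F 0)).
have := F_endo a 0; rewrite [in LHS]caddC cadd0x -!shape => ->.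
by rewrite caddC.
Qed.

Lemma sigma_endo_exists (c : R) : q * q * c = 0 ->
  exists F : R -> R, [/\ F 0 = c, injective F, sigma_endo F
  & forall i : nat, (iter i F 0 == 0) = (i%:R * c == 0)].
Proof.
move=> qqc; have [d xd p'd] := multiplier_exists c.
exists (fun b => cadd q c (cpow q d.+1 b)); split.
- by rewrite /cpow mul0r caddC cadd0x.
- by move=> b b' /Zpn_cadd_inj/(cpow_inj p'd).
- move=> a b; rewrite cpow_cadd ((twist_compatible ux xd).2 qqc).
  by rewrite !caddA [cadd q c (x * _)]caddC.
move=> i; rewrite iter_cadd_cpow cpow_eq0.
have [u uu qc] := twist_multiplier ux xd.
(* In R, d + 1 = 1 + q (c / u), so the exponent is itself a geometric sum and hence i up to a
   unit. *)
have -> : (\sum_(j < i) d.+1 ^ j)%N%:R = geo q i (c / u) :> R.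
  rewrite natr_sum; apply: eq_bigr => j _.
  by rewrite natrX mulrA qc mulrK // -natr1 addrC.
have [r ->] := geo_unit i (c / u).
by rewrite mulrAC (mulIr_eq0 _ (mulIr (unit_1pr r))).
Qed.

End Endomorphisms.

(** Such c are multiples of p^(n - r) for r = min(n, 2k). Through f -> f 0 this bounds the
    automorphism group from above. *)
Lemma card_annihilator :
  (#|[set c : R | (q * q * c == 0)%R]| <= p ^ minn n (2 * k))%N.
Proof.
set r := minn n (2 * k).
pose h (i : 'I_(p ^ r)) : R := (i * p ^ (n - r))%N%:R.
rewrite -[X in (_ <= X)%N]card_ord; apply: leq_trans (leq_imset_card h _).
apply/subset_leq_card/subsetP => c; rewrite inE {1}(Zpn_natrE c) -!natrM.
have c_lt : (c < p ^ n)%N.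
  by apply: leq_trans (ltn_ord c) _; rewrite Zp_cast // pn_gt1.
rewrite Zpn_natr_eq0 -expnD addnn -mul2n => pn_c.
have /dvdnP[i c_i] : (p ^ (n - r) %| c)%N.
  rewrite /r; case: leqP => [le_n2k | lt_2kn]; first by rewrite subnn dvd1n.
  move: pn_c; rewrite -{1}(subnKC (ltnW lt_2kn)) expnD dvdn_pmul2l //.
  by rewrite expn_gt0 prime_gt0.
have i_lt : (i < p ^ r)%N.
  move: c_lt; rewrite c_i -{2}(subnKC (geq_minl n (2 * k))) expnD.
  by rewrite ltn_pmul2r // expn_gt0 prime_gt0.
by apply/imsetP; exists (Ordinal i_lt) => //; rewrite /h /= -c_i -Zpn_natrE.
Qed.

End PrimePower.

(** * Transfer between the brace and Z/p^n *)

Lemma sol_AutP (A : finBraceType) (x : A) (f : {perm A}) :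
  reflect (forall a b, f (sigma x a b) = sigma x (f a) (f b))
          (f \in sol_Aut (cycle_base_sol x)).
Proof.
rewrite inE; apply: (iffP forallP) => [f_r a b | f_sigma [a b]].
  by have /eqP[] := f_r (a, b).
(* The second component is an inverse sigma applied to a, so commutation with the first component
   forces it. *)
rewrite /map_pair /cycle_base_sol /=; apply/eqP; congr (_, _) => //=.
rewrite -f_sigma; apply: (@perm_inj _ (sigma x (f (sigma x a b)))).
by rewrite permKV -f_sigma permKV.
Qed.

(** For n > 0 both types have modulus p^n but are not convertible, so [j] passes through the natural
    number representative to reach a type with a ring structure. *)
Lemma brace_coordinate (p n k : nat) (A : finBraceType)
    (iota : {additive A -> 'I_(p ^ n).-1.+1}) :
    prime p -> (0 < n)%N -> bijective iota ->
    (forall a b : A, iota (a \o+ b) =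
       iota a + iota b + Zp_mul (Zp_mul (iota a) (iota b)) (inZp (p ^ k))) ->
  exists j : A -> 'Z_(p ^ n),
    [/\ bijective j, {morph j : a b / a + b}
      & forall a b, j (a \o+ b) = cadd (p ^ k)%:R (j a) (j b)].
Proof.
move=> p_prime n_gt0 iota_bij circE.
have pnE : (p ^ n).-1.+1 = (p ^ n)%N by rewrite prednK // expn_gt0 prime_gt0.
have modE (m : nat) : (m %% (p ^ n).-1.+1)%N%:R = m%:R :> 'Z_(p ^ n).
  by apply/eqP; rewrite Zpn_natr_eq // pnE modn_mod.
have valD (u v : 'I_(p ^ n).-1.+1) :
    (nat_of_ord (u + v))%:R = (u : nat)%:R + (v : nat)%:R :> 'Z_(p ^ n).
  by rewrite -natrD -[RHS]modE.
have valM (u v : 'I_(p ^ n).-1.+1) :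
    (nat_of_ord (Zp_mul u v))%:R = (u : nat)%:R * (v : nat)%:R :> 'Z_(p ^ n).
  by rewrite -natrM -[RHS]modE.
exists (fun a => (iota a : nat)%:R); split.
- apply: inj_card_bij.
    have iota_lt a : (iota a < p ^ n)%N.
      by apply: leq_trans (ltn_ord (iota a)) _; rewrite pnE.
    move=> a b /eqP; rewrite Zpn_natr_eq // !modn_small // => /eqP.
    by move/ord_inj; apply: bij_inj.
  rewrite (bij_eq_card iota_bij) !card_ord pnE Zp_cast //.
  exact: pn_gt1.
- by move=> a b; rewrite raddfD valD.
by move=> a b; rewrite circE !valD !valM modE.
Qed.

(** * The automorphism group in the coordinate *)

Section CyclicBrace.

Variables (p n k : nat) (A : finBraceType) (j : A -> 'Z_(p ^ n)).
Hypotheses (p_prime : prime p) (n_gt0 : (0 < n)%N).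

Notation R := 'Z_(p ^ n).
Notation q := ((p ^ k)%:R : R).

Hypotheses (j_bij : bijective j) (jD : {morph j : a b / a + b}).
Hypothesis j_circ : forall a b, j (a \o+ b) = cadd q (j a) (j b).

Lemma j_0 : j 0 = 0.
Proof. by apply: (addrI (j 0)); rewrite -jD !addr0. Qed.

Lemma j_lambda a b : j (lambda a b) = j b * (1 + q * j a).
Proof.
by rewrite /lambda; apply: (addrI (j a)); rewrite -jD addNKr j_circ /cadd; ring.
Qed.

Lemma j_sigma x a b :
  j (sigma x a b) = cadd q (j x * (1 + q * j a)) (j b).
Proof. by rewrite permE j_circ j_lambda. Qed.

(* For [k = 0] the element [-1] would be absorbing for the circle product. *)
Lemma circ_exponent_gt0 : (0 < k)%N.
Proof.
have [g jK gK] := j_bij; rewrite lt0n; apply/eqP => k0.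
have absorb b : j (g (-1) \o+ b) = -1.
  by rewrite j_circ gK /cadd k0 expn0; ring.
have /circ_inj eq01 : g (-1) \o+ 0 = g (-1) \o+ g 1.
  by apply: (can_inj jK); rewrite !absorb.
by have /eqP := j_0; rewrite eq01 gK oner_eq0.
Qed.

Lemma j_circ_id : j (circ_id : A) = 0.
Proof.
have /(Zpn_cadd_inj p_prime n_gt0 circ_exponent_gt0) :
    cadd q (j circ_id) (j circ_id) = cadd q (j circ_id) 0.
  by rewrite -j_circ circ1x caddC cadd0x.
by [].
Qed.

(* For [p = 2], [k = 1] and [n > 1], both [-1] and [2 ^ (n - 1)] are
   involutions of the circle group. *)
Lemma circ_cyclic_exponent :
  cyclic [set: circ_group A] -> [|| n <= k, odd p | 1 < k]%N.
Proof.
move=> circ_cyclic; have [g jK gK] := j_bij; have k_gt0 := circ_exponent_gt0.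
apply/negPn; rewrite !negb_or -ltnNge -leqNgt; apply/negP.
case/and3P=> lt_kn p_even k_le1.
have {p_even} p2 : p = 2%N by case: (even_prime p_prime) p_even => // ->.
have {k_le1} k1 : k = 1%N by apply/eqP; rewrite eqn_leq k_le1.
have q2 : q = 2%:R by congr (_%:R); rewrite k1 expn1 p2.
have order2 r : cadd q r r = 0 -> r != 0 -> #[g r : circ_group A]%g = 2%N.
  move=> rr0 nz_r; apply: nt_prime_order => //.
    apply: (can_inj jK); rewrite [RHS]j_circ_id expgS expg1.
    by rewrite [LHS]j_circ gK.
  by apply: contra nz_r => /eqP gr1; rewrite -[r]gK gr1 j_circ_id.
have order_N1 : #[g (-1) : circ_group A]%g = 2%N.
  apply: order2; last by rewrite oppr_eq0 oner_eq0.
  by rewrite /cadd q2; ring.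
pose h : R := (p ^ n.-1)%:R.
have n1_gt0 : (0 < n.-1)%N by case: (n) lt_kn; rewrite k1 // => -[].
have h2 : h *+ 2 = 0.
  have pnE : (p ^ n.-1 * 2 = p ^ n)%N by rewrite p2 -expnSr prednK.
  by apply/eqP; rewrite -mulrnA pnE Zpn_natr_eq0.
have order_h : #[g h : circ_group A]%g = 2%N.
  apply: order2.
    have -> : cadd q h h = h *+ 2 * (1 + h) by rewrite /cadd q2; ring.
    by rewrite h2 mul0r.
  by rewrite Zpn_natr_eq0 // dvdn_Pexp2l ?prime_gt1 // -ltnNge ltn_predL.
(* A cyclic group has one subgroup of order 2, so [h] would be 0 or -1; but it has order 2 and, as n
   > 1, is not a unit. *)
have : (g h : circ_group A) \in <[g (-1) : circ_group A]>%g.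
  suff /eqP -> : <[g (-1) : circ_group A]>%g == <[g h : circ_group A]>%g.
    exact: cycle_id.
  rewrite (eq_subG_cyclic circ_cyclic) ?subsetT //.
  by rewrite -!orderE order_N1 order_h.
rewrite (cycle2g order_N1) !inE => /orP[/eqP gh1 | /eqP /(can_inj gK) hN1].
  by have := order_h; rewrite gh1 order1.
have : h \is a GRing.unit by rewrite hN1 unitrN1.
by rewrite Zpn_unit // dvdn_exp.
Qed.

(** Each lambda multiplies by a unit 1 + q a, so an orbit containing a non-unit lies in pR, a proper
    subgroup. [N] is pR, written as the annihilator of p^(n - 1). *)
Lemma transitive_cycle_base_unit C x :
  transitive_cycle_base C -> x \in C -> j x \is a GRing.unit.
Proof.
move=> [[y ->] gen_C] /imsetP[a0 _ x_a0]; have [g jK gK] := j_bij.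
apply/negPn/negP => nu_x.
pose N := [set a : A | (p ^ n.-1)%:R * j a == 0].
have N_mem a : (a \in N) = (j a \isn't a GRing.unit).
  rewrite inE [j a]Zpn_natrE -natrM Zpn_natr_eq0 // Zpn_unit // negbK.
  by rewrite -{1}(prednK n_gt0) expnSr dvdn_pmul2l // expn_gt0 prime_gt0.
have N_group : group_set N.
  apply/group_setP; split=> [|a b]; first by rewrite inE j_0 mulr0.
  by rewrite !inE jD mulrDr => /eqP -> /eqP ->; rewrite addr0.
have lambda_unit a : (j (lambda a y) \is a GRing.unit) = (j y \is a GRing.unit).
  by rewrite j_lambda unitrM unit_1q ?andbT // circ_exponent_gt0.
have : <<[set lambda a y | a : A]>>%g \subset Group N_group.
  rewrite gen_subG; apply/subsetP => _ /imsetP[a _ ->].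
  by rewrite [_ \in _]N_mem lambda_unit -(lambda_unit a0) -x_a0.
rewrite gen_C => /subsetP/(_ (g 1)); rewrite inE => /(_ isT).
by rewrite [_ \in _]N_mem gK unitr1.
Qed.

Lemma sol_Aut_cyclic_order x :
    [|| n <= k, odd p | 1 < k]%N -> j x \is a GRing.unit ->
  cyclic (sol_Aut (cycle_base_sol x)) /\
  #|sol_Aut (cycle_base_sol x)| = (p ^ minn n (2 * k))%N.
Proof.
move=> k_tame ux; have [g jK gK] := j_bij; have k_gt0 := circ_exponent_gt0.
set G := sol_Aut _; set r := minn n (2 * k).
pose conj (f : {perm A}) b := j (f (g b)).
have conj_endo f : f \in G -> sigma_endo k (j x) (conj f).
  move=> /sol_AutP f_sigma a b; rewrite /conj -j_sigma -f_sigma.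
  by rewrite -{1}[a]gK -{1}[b]gK -j_sigma jK.
have leG : (#|G| <= p ^ r)%N.
  apply: leq_trans (card_annihilator p_prime n_gt0 k).
  rewrite -(@card_in_imset _ _ (fun f => conj f 0)); last first.
    move=> f f' Gf Gf' eq0; apply/permP => a; apply: (can_inj jK).
    have /(_ (j a)) := sigma_endo_eq p_prime n_gt0 k_gt0 k_tame ux
      (conj_endo f Gf) (conj_endo f' Gf') eq0.
    by rewrite /conj jK.
  apply/subset_leq_card/subsetP => _ /imsetP[f Gf ->]; rewrite inE; apply/eqP.
  exact: (sigma_endo_image0 p_prime n_gt0 k_gt0 k_tame ux (conj_endo f Gf)).
pose c : R := (p ^ (n - r))%:R.
(* [c] generates the annihilator of q^2, so it should yield an automorphism of the largest order. *)
have qqc : q * q * c = 0.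
  apply/eqP; rewrite -!natrM Zpn_natr_eq0 // -!expnD dvdn_exp2l //.
  by rewrite addnn -mul2n /r; lia.
have [F [F0 F_inj F_endo F_iter]] :=
  sigma_endo_exists p_prime n_gt0 k_gt0 k_tame ux qqc.
have f_inj : injective (fun a => g (F (j a))).
  by move=> a b /(can_inj gK)/F_inj/(can_inj jK).
pose f := perm f_inj.
have Gf : f \in G.
  apply/sol_AutP => a b; rewrite !(permE f_inj); apply: (can_inj jK).
  by rewrite gK !j_sigma F_endo !gK.
have f_iter i : j ((f ^+ i)%g (g 0)) = iter i F 0.
  elim: i => [|i IHi]; first by rewrite perm1 gK.
  by rewrite expgSr permM permE gK IHi.
(* If N is the order of [f], then f^N fixes 0, which means N p^(n - r) = 0; hence p^r | N, which
   meets the bound [leG]. *)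
have p_ord : (p ^ r %| #[f]%g)%N.
  have := F_iter #[f]%g; rewrite -f_iter expg_order perm1 gK eqxx /c -natrM.
  move/esym; rewrite Zpn_natr_eq0 //.
  rewrite -{1}(subnK (geq_minl n (2 * k))) expnD [(#[f]%g * _)%N]mulnC.
  rewrite dvdn_pmul2l //.
  by rewrite expn_gt0 prime_gt0.
have G_f : <[f]>%g = G.
  apply/eqP; rewrite eqEcard cycle_subG Gf; apply: leq_trans leG _.
  exact: dvdn_leq p_ord.
split; first by rewrite -G_f cycle_cyclic.
apply/eqP; rewrite eqn_leq leG -G_f; exact: dvdn_leq p_ord.
Qed.

End CyclicBrace.

(** * Comparison of cyclic groups by their orders *)

Lemma cyclic_imset_mulrn (A : finZmodType) (m : nat) :
  cyclic [set: A] -> exists H : {group A},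
    [/\ [set a *+ m | a : A] = H :> {set A}, cyclic H
      & #|H| = (#|A| %/ gcdn #|A| m)%N].
Proof.
case/cyclicP=> g gen_g; exists <[g ^+ m]>%G; split.
- apply/setP => b; apply/imsetP/cycleP => [[a _ ->] | [i ->]].
    have : a \in <[g]>%g by rewrite -gen_g.
    by case/cycleP => i ->; exists i; rewrite -expgM mulnC expgM.
  by exists (g ^+ i)%g; rewrite // -expgM mulnC expgM.
- exact: cycle_cyclic.
by rewrite -orderE orderXgcd orderE -gen_g cardsT.
Qed.

(* Z/p^n is 'I_(p ^ n).-1.+1 (not 'Z_(p ^ n), which is Z/2 when n = 0); Zp_mul
   and inZp are the product and the reduction map nat -> Z/p^n. *)
Theorem theorem6p13 (p n : nat) (p_prime : prime p)
    (A : finBraceType) (cardA : #|A| = (p ^ n)%N)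
    (add_cyclic : cyclic [set: A])
    (circ_cyclic : cyclic [set: circ_group A])
    (iota : {additive A -> 'I_(p ^ n).-1.+1}) (iota_bij : bijective iota)
    (x : A) (C : {set A}) (C_base : transitive_cycle_base C) (xC : x \in C)
    (k : nat)
    (circE : forall a b : A,
       iota (a \o+ b) =
         iota a + iota b + Zp_mul (Zp_mul (iota a) (iota b)) (inZp (p ^ k))) :
  (sol_Aut (cycle_base_sol x) \isog [set: A] <-> k = 0%N \/ (n <= 2 * k)%N) /\
  (~ (k = 0%N \/ (n <= 2 * k)%N) ->
     sol_Aut (cycle_base_sol x) \isog [set a *+ (p ^ (n - 2 * k)) | a : A]).
Proof.
have [G_cyclic cardG] : cyclic (sol_Aut (cycle_base_sol x)) /\
    #|sol_Aut (cycle_base_sol x)| = (p ^ minn n (2 * k))%N.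
  (* For n = 0 the brace is a point and 'Z_(p ^ n) has the wrong size, so there is no coordinate. *)
  have [n0 | n_gt0] := posnP n.
    have /fintype_le1P A_eq : (#|A| <= 1)%N by rewrite cardA n0.
    have -> : sol_Aut (cycle_base_sol x) = 1%g.
      apply/eqP; rewrite eqEsubset sub1G andbT; apply/subsetP => f _.
      rewrite inE; apply/eqP/permP => a.
      by rewrite (A_eq x (f a)) (A_eq x (_ a)).
    by rewrite cyclic1 cards1 n0 min0n expn0.
  have [j [j_bij jD j_circ]] := brace_coordinate p_prime n_gt0 iota_bij circE.
  apply: (sol_Aut_cyclic_order p_prime n_gt0 j_bij jD j_circ).
    exact: (circ_cyclic_exponent p_prime n_gt0 j_bij jD j_circ circ_cyclic).
  exact: (transitive_cycle_base_unit p_prime n_gt0 j_bij jD j_circ C_base xC).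
(* k = 0 forces n = 0, so the disjunction amounts to n <= 2 k. *)
have n_eq0 : k = 0%N -> n = 0%N.
  move=> k0; apply/eqP; rewrite -leqn0 leqNgt; apply/negP => n_gt0.
  have [j [j_bij jD j_circ]] := brace_coordinate p_prime n_gt0 iota_bij circE.
  by have := circ_exponent_gt0 j_bij jD j_circ; rewrite k0.
have smallE : k = 0%N \/ (n <= 2 * k)%N <-> (n <= 2 * k)%N.
  by split=> [[/n_eq0 -> | ] |] //; right.
split.
  rewrite smallE (isog_cyclic_card _ G_cyclic) add_cyclic cardG cardsT cardA /=.
  rewrite eqn_exp2l ?prime_gt1 // eq_sym.
  by split=> [/eqP/minn_idPl | /minn_idPl ->].
rewrite smallE => /negP; rewrite -ltnNge => lt_2kn.
have [H [-> H_cyclic cardH]] :=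
  cyclic_imset_mulrn (p ^ (n - 2 * k)) add_cyclic.
rewrite (isog_cyclic_card _ G_cyclic) H_cyclic cardG cardH cardA.
have -> : minn n (2 * k) = (2 * k)%N by apply/minn_idPr/ltnW.
have -> : gcdn (p ^ n) (p ^ (n - 2 * k)) = (p ^ (n - 2 * k))%N.
  by apply/gcdn_idPr; rewrite dvdn_exp2l // leq_subr.
by rewrite -expnB ?prime_gt0 ?leq_subr // subKn ?eqxx // ltnW.
Qed.
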